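(* For every finite simple graph $G$ of diameter at most $2$, $\gamma(G)=\tau_{ST}(G)$.
   Context: The diameter of $G$ is $\max_{u,v\in V(G)}\mathrm{dist}_G(u,v)$; in particular a graph of diameter at most $2$ is connected. $\gamma(G)$ denotes the domination number of $G$, i.e. the minimum size of a set $D\subseteq V(G)$ such that every vertex not in $D$ has a neighbor in $D$. For a connected graph $G$, $\tau_{ST}(G)$ denotes the minimum, over all spanning trees $T$ of $G$, of the size of a minimum vertex cover of $T$ (a vertex cover of $T$ is a set $C$ of vertices such that every edge of $T$ has at least one endpoint in $C$).
   Formalization: The graph is assumed to have at least two vertices, because the claim fails for the one-vertex graph: it has diameter 0 and domination number 1, but its only spanning tree has no edges and so vertex cover number 0. *)

(* Defs.v *)
From mathcomp Require Import all_boot.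

Set Implicit Arguments.
Unset Strict Implicit.
Unset Printing Implicit Defensive.

(* A finite simple graph on V is its set of edges, each an unordered pair of
   distinct vertices. *)
Definition sgraph (V : finType) : Type :=
  {E : {set {set V}} | [forall e in E, #|e| == 2]}.

Definition edges (V : finType) (G : sgraph V) : {set {set V}} := val G.

Definition adj (V : finType) (G : sgraph V) : rel V :=
  [rel u v | [set u; v] \in edges G].

Definition walk (V : finType) (G : sgraph V) (u v : V) (n : nat) : bool :=
  [exists p : n.-tuple V, path (adj G) u p && (last u p == v)].

(* The least length of a walk from u to v; None stands for infinity. Searching
   below #|V| loses nothing, see dist_Some and dist_None. *)
Definition dist (V : finType) (G : sgraph V) (u v : V) : option nat :=
  ohead [seq n <- iota 0 #|V| | walk G u v n].

(* None stands for infinity. *)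
Definition diameter (V : finType) (G : sgraph V) : option nat :=
  if [forall u, forall v, dist G u v != None]
  then Some (\max_u \max_v odflt 0 (dist G u v)) else None.

(* In the three minima below, the default value #|V| is an upper bound of all
   the quantities being minimized, so it is harmless as soon as the range of
   the minimum is nonempty. *)

Definition dominating (V : finType) (G : sgraph V) (D : {set V}) : bool :=
  [forall v, (v \notin D) ==> [exists u in D, adj G u v]].

Definition domination_number (V : finType) (G : sgraph V) : nat :=
  \big[minn/#|V|]_(D : {set V} | dominating G D) #|D|.

Definition vertex_cover (V : finType) (G : sgraph V) (C : {set V}) : bool :=
  [forall e in edges G, e :&: C != set0].

Definition vertex_cover_number (V : finType) (G : sgraph V) : nat :=
  \big[minn/#|V|]_(C : {set V} | vertex_cover G C) #|C|.

Definition connected (V : finType) (G : sgraph V) : bool :=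
  (0 < #|V|) && [forall u, forall v, connect (adj G) u v].

(* A cycle has no repeated vertex, hence at most #|V| vertices. *)
Definition acyclic (V : finType) (G : sgraph V) : bool :=
  [forall n : 'I_#|V|.+1, forall c : n.-tuple V,
    ~~ [&& 2 < n, uniq c & cycle (adj G) c]].

Definition tree (V : finType) (G : sgraph V) : bool := connected G && acyclic G.

Definition spanning_tree (V : finType) (G T : sgraph V) : bool :=
  (edges T \subset edges G) && tree T.

(* Only meaningful for connected G (otherwise there is no spanning tree). *)
Definition tau_ST (V : finType) (G : sgraph V) : nat :=
  \big[minn/#|V|]_(T : sgraph V | spanning_tree G T) vertex_cover_number T.

Lemma adj_sym (V : finType) (G : sgraph V) : symmetric (adj G).
Proof. by move=> u v; rewrite /adj /= setUC. Qed.

Lemma adj_irrefl (V : finType) (G : sgraph V) : irreflexive (adj G).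
Proof.
move=> u; apply/negP => /= h; have /forall_inP/(_ _ h) := valP G.
by rewrite setUid cards1.
Qed.

Lemma walkP (V : finType) (G : sgraph V) (u v : V) (n : nat) :
  reflect (exists p, [/\ size p = n, path (adj G) u p & last u p = v])
          (walk G u v n).
Proof.
apply: (iffP existsP) => [[p /andP[pp /eqP lp]]|[p [sp pp lp]]].
  by exists p; rewrite size_tuple.
by rewrite -{}sp; exists (in_tuple p); rewrite /= pp lp eqxx.
Qed.

Lemma walk_shorten (V : finType) (G : sgraph V) (u v : V) (n : nat) :
  walk G u v n -> exists2 m, m <= n & (m < #|V|) && walk G u v m.
Proof.
case/walkP=> p [<- pp <-]; case/shortenP: pp => p' pp' up' sub.
have s1 : size p' < #|V| by have := max_card (mem (u :: p')); rewrite (card_uniqP up').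
exists (size p'); last by rewrite s1; apply/walkP; exists p'.
by apply: uniq_leq_size (sub) => //; case/andP: up'.
Qed.

Lemma dist_Some (V : finType) (G : sgraph V) (u v : V) (n : nat) :
  dist G u v = Some n <->
  walk G u v n /\ (forall m, walk G u v m -> n <= m).
Proof.
rewrite /dist; set s := filter _ _.
have ss : sorted ltn s by apply: sorted_filter (iota_ltn_sorted _ _) => //; apply: ltn_trans.
have ms m : (m \in s) = walk G u v m && (m < #|V|) by rewrite mem_filter mem_iota.
split=> [|[wn mn]].
  case es: s => [//|k t] [<-].
  have := ms k; rewrite es mem_head => /esym/andP[wk _]; split=> // m /walk_shorten[j jm].
  rewrite andbC -ms es inE => /orP[/eqP<- //|jt]; apply: leq_trans jm.
  move: ss; rewrite es /= (path_sortedE ltn_trans) => /andP[/allP/(_ _ jt) kj _].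
  exact: ltnW.
have ns : n \in s.
  have [j jn /andP[jV wj]] := walk_shorten wn.
  by rewrite ms wn (leq_ltn_trans (mn _ wj) jV).
case es: s ns ss => [//|k t]; rewrite inE => /orP[/eqP-> //|nt] /=.
rewrite (path_sortedE ltn_trans) => /andP[/allP/(_ _ nt) kn _].
have := ms k; rewrite es mem_head => /esym/andP[/mn nk _].
by have := leq_ltn_trans nk kn; rewrite ltnn.
Qed.

Lemma dist_None (V : finType) (G : sgraph V) (u v : V) :
  dist G u v = None <-> ~~ connect (adj G) u v.
Proof.
split=> [dN|/negP nc].
  apply/negP => /connectP[p pp lp].
  have /walk_shorten[m _ /andP[mV wm]] : walk G u v (size p).
    by apply/walkP; exists p.
  have : m \in [seq n <- iota 0 #|V| | walk G u v n] by rewrite mem_filter wm mem_iota.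
  by move: dN; rewrite /dist; case: filter.
case dE: dist => [n|//]; case/dist_Some: dE => /walkP[p [_ pp lp]] _.
by case: nc; apply/connectP; exists p.
Qed.

Lemma acyclicP (V : finType) (G : sgraph V) :
  reflect (forall c, 2 < size c -> uniq c -> ~~ cycle (adj G) c) (acyclic G).
Proof.
apply: (iffP forallP) => [ac c sc uc|ac n]; last first.
  apply/forallP => c; apply/negP => /and3P[n2 uc cc].
  by have := ac c; rewrite size_tuple cc => /(_ n2 uc).
have cV : size c < #|V|.+1 by rewrite ltnS -(card_uniqP uc) max_card.
by have /forallP/(_ (in_tuple c)) := ac (Ordinal cV); rewrite /= sc uc.
Qed.

(* Main.v *)
Require Import Defs.
From mathcomp Require Import all_boot.

(** If D dominates a graph of diameter at most 2, then the edges meeting D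
    already form a connected spanning subgraph: each vertex has a neighbor in D
    or lies in D, and two vertices of D are adjacent or have a common neighbor.
    So D covers any spanning tree of that subgraph. Conversely, a vertex of a
    spanning tree T outside a vertex cover C of T has a neighbor in T, which
    must belong to C; so C dominates. *)

(** [minn] has no neutral element on [nat], so the default [x] really takes part in the minimum and
    must be bounded as well. *)
Lemma bigminn_leP (I : finType) (P : pred I) (F : I -> nat) (x m : nat) :
  reflect (m <= x /\ forall i, P i -> m <= F i)
          (m <= \big[minn/x]_(i | P i) F i).
Proof.
apply: (iffP idP) => [le_m|[mx mF]]; last first.
  by elim/big_ind: _ => // a b ma mb; rewrite leq_min ma.
have {le_m} : m <= x /\ {in index_enum I, forall i, P i -> m <= F i}.
  elim: (index_enum I) le_m => [|j s IHs]; first by rewrite big_nil.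
  rewrite big_cons; case: ifP => [Pj|NPj].
    rewrite leq_min => /andP[mj /IHs[mx ms]]; split=> // i.
    by rewrite inE => /predU1P[->//|/ms].
  by move=> /IHs[mx ms]; split=> // i; rewrite inE => /predU1P[->|/ms//]; rewrite NPj.
by case=> mx mF; split=> // i; apply: mF; rewrite mem_index_enum.
Qed.

Lemma bigminn_le (I : finType) (P : pred I) (F : I -> nat) (x : nat) (i : I) :
  P i -> \big[minn/x]_(j | P j) F j <= F i.
Proof. by have /bigminn_leP[_] := leqnn (\big[minn/x]_(j | P j) F j); apply. Qed.

Lemma bigminn_le_idx (I : finType) (P : pred I) (F : I -> nat) (x : nat) :
  \big[minn/x]_(j | P j) F j <= x.
Proof. by have /bigminn_leP[] := leqnn (\big[minn/x]_(j | P j) F j). Qed.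

Section Graph.
Variable V : finType.
Implicit Types (G H T : sgraph V) (C D : {set V}) (F : {set {set V}}).

Lemma subgraph_ex G F : F \subset edges G -> exists H, edges H = F.
Proof.
move=> /subsetP sFG.
have pF : [forall e in F, #|e| == 2].
  by apply/forall_inP => e /sFG; move: e; apply/forall_inP/(valP G).
by exists (exist _ F pF).
Qed.

Lemma connected_connect G u v : connected G -> connect (adj G) u v.
Proof. by case/andP=> _ /forallP/(_ u)/forallP. Qed.

Lemma connect_adj_sym G : connect_sym (adj G).
Proof. exact: sym_connect_sym (@adj_sym _ G). Qed.

Lemma adj_neq G u v : adj G u v -> u != v.
Proof. by move=> auv; apply: contraTneq auv => ->; rewrite adj_irrefl. Qed.

(** The rest of the cycle is a detour between [x] and [y] that avoids the deleted edge, so it can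
    replace that edge in any walk. *)
Lemma connected_del_edge T T' x y (p : seq V) :
    edges T' = edges T :\ [set x; y] -> connected T ->
    1 < size (y :: p) -> uniq (x :: y :: p) -> cycle (adj T) (x :: y :: p) ->
  connected T'.
Proof.
move=> eT' cT; case: p => [//|z p] _ U /= /and3P[axy ayz pz].
have adjT' u v : adj T' u v = ([set u; v] != [set x; y]) && adj T u v.
  by rewrite /adj /= eT' !inE.
have cxy : connect (adj T') x y.
  (* The detour starts with the edge from [y] to [z], where [z] differs from [x]; from [z] on it
     never returns to [y], so none of its later edges is the deleted one. *)
  rewrite connect_adj_sym; apply: (@connect_trans _ _ z).
    apply: connect1; rewrite adjT' ayz andbT.
    apply: contraTneq U => /setP/(_ x); rewrite /= !inE eqxx /=.
    by case/orP=> ->; rewrite ?orbT.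
  apply/connectP; exists (rcons p x); last by rewrite last_rcons.
  move: pz; apply: (@sub_in_path _ (predC1 y)) => [u v|].
    rewrite !inE adjT' => uy vy ->; rewrite andbT.
    apply/eqP => /setP/(_ y).
    by rewrite !inE eqxx orbT eq_sym (negPf uy) eq_sym (negPf vy).
  move: U; rewrite /= !inE !negb_or => /and3P[/and3P[xy xz xp] /andP[yz yp] _].
  rewrite eq_sym yz all_rcons /= xy /=.
  by apply/allP => w wp; apply: contraNneq yp => <-.
have [V0 _] := andP cT.
rewrite /connected V0; apply/forallP => u; apply/forallP => v.
have := connected_connect _ u v cT; apply: connect_sub => {u v} u v auv.
have [e|ne] := eqVneq [set u; v] [set x; y]; last by apply: connect1; rewrite adjT' ne.
have : u \in [set x; y] by rewrite -e !inE eqxx.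
have : v \in [set x; y] by rewrite -e !inE eqxx orbT.
have := adj_neq _ _ _ auv; rewrite !inE => + /orP[]/eqP-> /orP[]/eqP->; rewrite ?eqxx //.
by rewrite connect_adj_sym.
Qed.

(** Among the connected spanning subgraphs, one with the fewest edges is acyclic: otherwise an edge
    of a cycle could be deleted. *)
Lemma spanning_tree_ex G : connected G -> exists T, spanning_tree G T.
Proof.
move=> cG; pose P := [pred H | (edges H \subset edges G) && connected H].
have PG : P G by rewrite /= subxx.
case: (arg_minnP (fun H => #|edges H|) PG) => T /andP[sTG cT] minT.
exists T; rewrite /spanning_tree sTG /tree cT /=; apply/acyclicP => c c2 Uc.
apply/negP => cc; case: c c2 Uc cc => [|x [|y p]] // c2 Uc cc.
have sT : edges T :\ [set x; y] \subset edges T by apply: subD1set.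
have [T' eT'] := subgraph_ex _ _ sT.
have cT' := connected_del_edge _ _ _ _ _ eT' cT c2 Uc cc.
have := minT T'; rewrite /= cT' eT' (subset_trans sT sTG) => /(_ isT).
have xyT : [set x; y] \in edges T by case/andP: cc.
by rewrite leqNgt [X in _ < X](cardsD1 [set x; y]) xyT ltnSn.
Qed.

(** With a single vertex the empty set covers the tree without dominating it. A second vertex [w]
    forces a tree edge at [v], namely the first edge of a path from [v] to [w]. *)
Lemma cover_spanning_tree_dominating G T C :
  1 < #|V| -> spanning_tree G T -> vertex_cover T C -> dominating G C.
Proof.
move=> V1 /andP[/subsetP sTG /andP[cT _]] /forall_inP covC.
apply/forallP => v; apply/implyP => vC.
have [w wv] : exists w, w != v.
  have /card_gt0P[w] : 0 < #|predC1 v| by move: V1; rewrite (cardC1 v) -subn1 subn_gt0.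
  by exists w.
have /connectP[[|u p] /=] := connected_connect _ v w cT.
  by move=> _ wE; rewrite wE eqxx in wv.
case/andP=> avu _ _; have /set0Pn[z] := covC _ avu.
rewrite !inE => /andP[/orP[]/eqP-> zC]; first by rewrite zC in vC.
by apply/exists_inP; exists u; rewrite // adj_sym; apply: sTG.
Qed.

Lemma diameter_le2 G d u v :
    diameter G = Some d -> d <= 2 ->
  [|| u == v, adj G u v | [exists w, adj G u w && adj G w v]].
Proof.
rewrite /diameter; case: ifP => // /forallP/(_ u)/forallP/(_ v) + [<-] d2.
case E: (dist G u v) => [n|] // _.
have : n <= 2.
  apply: leq_trans d2; have -> : n = odflt 0 (dist G u v) by rewrite E.
  apply: (leq_trans (leq_bigmax (F := fun w => odflt 0 (dist G u w)) v)).
  exact: (leq_bigmax (F := fun w => \max_t odflt 0 (dist G w t))).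
have /dist_Some[/walkP[p [<- pp <-]] _] := E.
(* A walk of length 0, 1 or 2 yields the three alternatives in this order. *)
case: p pp => [|a [|b []]] //=; rewrite ?eqxx ?andbT //.
  by move=> -> _; rewrite orbT.
by move=> aab _; do 2![apply/orP; right]; apply/existsP; exists a.
Qed.

Lemma dominating_tree_cover G D d :
    0 < #|V| -> diameter G = Some d -> d <= 2 -> dominating G D ->
  exists2 T, spanning_tree G T & vertex_cover T D.
Proof.
move=> V0 dG d2 /forallP domD.
pose F := [set e in edges G | e :&: D != set0].
have sFG : F \subset edges G by apply/subsetP => e; rewrite inE => /andP[].
have [H eH] := subgraph_ex _ _ sFG.
have adjH u v : u \in D -> adj G u v -> adj H u v.
  move=> uD auv; rewrite /adj /= eH inE; apply/andP; split=> //.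
  by apply/set0Pn; exists u; rewrite !inE eqxx.
have toD u : exists2 x, x \in D & connect (adj H) u x.
  have [uD|uD] := boolP (u \in D); first by exists u.
  have /implyP/(_ uD)/exists_inP[x xD axu] := domD u.
  by exists x => //; rewrite connect_adj_sym connect1 // adjH.
have inD x y : x \in D -> y \in D -> connect (adj H) x y.
  move=> xD yD; case/or3P: (diameter_le2 _ _ x y dG d2) => [/eqP->//|axy|].
    by apply: connect1; apply: adjH.
  case/existsP=> w /andP[axw awy]; apply: (@connect_trans _ _ w).
    by apply: connect1; apply: adjH.
  by apply: connect1; rewrite adj_sym; apply: adjH => //; rewrite adj_sym.
have cH : connected H.
  rewrite /connected V0; apply/forallP => u; apply/forallP => v.
  have [[x xD ux] [y yD vy]] := (toD u, toD v).
  apply: connect_trans ux _; apply: connect_trans (inD x y xD yD) _.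
  by rewrite connect_adj_sym.
have [T /andP[sTH tT]] := spanning_tree_ex _ cH; rewrite eH in sTH.
exists T; first by rewrite /spanning_tree (subset_trans sTH sFG).
by apply/forall_inP => e /(subsetP sTH); rewrite inE => /andP[].
Qed.

End Graph.

Theorem theorem1 (V : finType) (G : sgraph V) (d : nat)
    (hV : 1 < #|V|)
    (hdiam : diameter G = Some d) (hd : d <= 2) :
  domination_number G = tau_ST G.
Proof.
have V0 := ltnW hV.
(* All three minima have the same default [#|V|], so the bounds on the defaults are immediate. What
   remains is to compare with each cover of each spanning tree, then with each dominating set. *)
apply/eqP; rewrite eqn_leq; apply/andP; split; apply/bigminn_leP.
  split=> [|T sT]; first exact: bigminn_le_idx.
  apply/bigminn_leP; split=> [|C cC]; first exact: bigminn_le_idx.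
  exact/bigminn_le/(cover_spanning_tree_dominating _ _ T).
split=> [|D domD]; first exact: bigminn_le_idx.
have [T sT cT] := dominating_tree_cover _ _ _ _ V0 hdiam hd domD.
by apply: (@leq_trans (vertex_cover_number T)); apply: bigminn_le.
Qed.
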